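(* Let $\alpha\in[0,1]$, let $F_s\ne F_b$ be CDFs on $\mathbb{R}$ and $F=\alpha F_s+(1-\alpha)F_b$. Suppose that $F=\kappa F^{(a)}+(1-\kappa)F^{(d)}$, where $F^{(a)}$ is an absolutely continuous CDF and $F^{(d)}$ is a piecewise constant CDF, for some $\kappa\in(0,1)$. Then the mixture model $F=\alpha F_s+(1-\alpha)F_b$ is identifiable if either $F^{(a)}$ or $F^{(d)}$ is identifiable (in the sense defined in the context).
   Context: A piecewise constant CDF is the CDF of a purely atomic probability measure. For CDFs $H,H_b$ put $\alpha_0(H,H_b):=\inf\{\gamma\in(0,1]:[H-(1-\gamma)H_b]/\gamma\text{ is a CDF}\}$. A mixture representation $H=aH_s+(1-a)H_b$ (with $a\in[0,1]$ and $H_s,H_b$ CDFs) is called identifiable if $\alpha_0(H,H_b)=a$. Write $F_s=\kappa_sF_s^{(a)}+(1-\kappa_s)F_s^{(d)}$ and $F_b=\kappa_bF_b^{(a)}+(1-\kappa_b)F_b^{(d)}$ with $\kappa_s,\kappa_b\in(0,1)$, where $F_s^{(a)},F_b^{(a)}$ are absolutely continuous CDFs and $F_s^{(d)},F_b^{(d)}$ are piecewise constant CDFs. Then $\kappa=\alpha\kappa_s+(1-\alpha)\kappa_b$, $F^{(a)}=\alpha^{(a)}F_s^{(a)}+(1-\alpha^{(a)})F_b^{(a)}$ with $\alpha^{(a)}=\alpha\kappa_s/\kappa$, and $F^{(d)}=\alpha^{(d)}F_s^{(d)}+(1-\alpha^{(d)})F_b^{(d)}$ with $\alpha^{(d)}=\alpha(1-\kappa_s)/(1-\kappa)$.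 ''$F^{(a)}$ is identifiable'' means $\alpha_0(F^{(a)},F_b^{(a)})=\alpha^{(a)}$, and ''$F^{(d)}$ is identifiable'' means $\alpha_0(F^{(d)},F_b^{(d)})=\alpha^{(d)}$. *)

(* Defs.v *)
From mathcomp Require Export all_boot all_order all_algebra.
From mathcomp Require Export all_classical all_reals all_analysis.

Set Implicit Arguments.
Unset Strict Implicit.
Unset Printing Implicit Defensive.

Import Order.TTheory GRing.Theory Num.Theory.
Import numFieldNormedType.Exports.

Local Open Scope classical_set_scope.
Local Open Scope ring_scope.

Definition is_cdf_of (R : realType) (P : probability (measurableTypeR R) R)
  (F : R -> R) : Prop := forall x : R, (F x)%:E = P `]-oo, x]%classic.

Definition is_cdf (R : realType) (F : R -> R) : Prop :=
  exists P : probability (measurableTypeR R) R, is_cdf_of P F.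

Definition is_atom (d : measure_display) (T : measurableType d) (R : realType)
  (mu : {measure set T -> \bar R}) (A : set T) : Prop :=
  [/\ measurable A, (0 < mu A)%E &
      forall B, measurable B -> B `<=` A -> mu B = 0%E \/ mu B = mu A].

Definition purely_atomic (d : measure_display) (T : measurableType d)
  (R : realType) (mu : {measure set T -> \bar R}) : Prop :=
  forall A, measurable A -> (0 < mu A)%E -> exists2 B, B `<=` A & is_atom mu B.

(* The law of F is absolutely continuous with respect to Lebesgue measure. *)
Definition abs_continuous_cdf (R : realType) (F : R -> R) : Prop :=
  exists2 P : probability (measurableTypeR R) R,
    is_cdf_of P F & P `<< (@lebesgue_measure R).

(* No step-function condition is imposed on F: the jump points may be dense,
   as for a law charging every rational. *)
Definition piecewise_constant_cdf (R : realType) (F : R -> R) : Prop :=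
  exists2 P : probability (measurableTypeR R) R,
    is_cdf_of P F & purely_atomic P.

Definition mixture (R : realType) (a : R) (G H : R -> R) : R -> R :=
  fun x => a * G x + (1 - a) * H x.

(* When H is a CDF, g = 1 belongs to the set, so this is the infimum of a
   nonempty set bounded below by 0. *)
Definition alpha0 (R : realType) (H Hb : R -> R) : R :=
  inf [set g : R | 0 < g <= 1 /\ is_cdf (fun x => (H x - (1 - g) * Hb x) / g)].

(* Identifiability of a representation H = mixture a Hs Hb; Hs enters only
   through H. *)
Definition identifiable (R : realType) (H : R -> R) (a : R) (Hb : R -> R) :
  Prop := alpha0 H Hb = a.

(* Main.v *)
From HB Require Import structures.
Require Import Defs.
From mathcomp Require Import all_boot all_order all_algebra.
From mathcomp Require Import all_classical all_reals all_analysis.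
From mathcomp Require Import ring lra.

(** If [F = g G + (1 - g) F_b] with [G] a CDF, the same identity holds between
   laws. The law of [G] need not be given as a mixture, but restricting the
   identity to a Borel set [M] carrying the absolutely continuous parts and
   negligible for the atomic ones (the complement of a countable set), or to the
   complement of [M], exhibits [F_a], respectively [F_d], as a mixture with
   background [F_ba], respectively [F_bd], whose signal is [G] conditioned on [M],
   respectively on its complement, and whose background weight is
   [(1 - g) kappa_b / kappa], respectively
   [(1 - g) (1 - kappa_b) / (1 - kappa)]. If [g < alpha], this weight is too
   large for the component to be identifiable. *)

Import Order.TTheory GRing.Theory Num.Theory.
Import numFieldNormedType.Exports.

Local Open Scope classical_set_scope.
Local Open Scope ring_scope.

(** * Laws on the line and their CDFs *)

(** The defining generators are the intervals []a, b]], and each of them is a difference of two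
    rays. *)
Lemma measurableTypeR_rays (R : realType) :
  @measurable _ (measurableTypeR R) = <<s range (fun x : R => `]-oo, x]%classic) >>.
Proof.
rewrite eqEsubset; split => [A|].
  apply: smallest_sub; first exact: smallest_sigma_algebra.
  move=> _ [[a b] _ <-] /=.
  have -> : `]a, b]%classic = `]-oo, b] `\` `]-oo, a] :> set R.
    rewrite setDE setCitvl; apply/seteqP; split=> x /=; rewrite !in_itv /= andbT.
      by move=> /andP[].
    by move=> [-> ->].
  apply: (@measurableD _ (g_sigma_algebraType
    (range (fun x : R => `]-oo, x]%classic)))); by apply: sub_sigma_algebra; eexists.
apply: smallest_sub; first exact: sigma_algebra_measurable.
by move=> _ [x _ <-]; exact: measurable_itv.
Qed.

(** Rays form a generating class closed under intersection, and those with integer endpoints exhaust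
    the line with finite mass, so Dynkin's uniqueness argument applies. *)
Lemma finite_measure_unique_rays (R : realType)
    (m1 m2 : {measure set (measurableTypeR R) -> \bar R}) :
  (forall x : R, (m1 `]-oo, x]%classic < +oo)%E) ->
  (forall x : R, m1 `]-oo, x]%classic = m2 `]-oo, x]%classic) ->
  forall A, measurable A -> m1 A = m2 A.
Proof.
move=> m1fin m12 A mA.
apply: (@measure_unique _ _ (measurableTypeR R) (range (fun x : R => `]-oo, x]%classic))
  (fun n => `]-oo, n%:R]%classic)) => //.
- exact: measurableTypeR_rays.
- move=> _ _ [x _ <-] [y _ <-]; exists (Num.min x y) => //.
  by apply/seteqP; split=> z /=; rewrite !in_itv /= le_min;
    [move=> /andP[]|move=> [-> ->]].
- rewrite -subTset => x _; exists (Num.truncn `|x|).+1 => //=.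
  by rewrite in_itv /= (le_trans (ler_norm x)) // ltW // truncnS_gt.
- by move=> _ [x _ <-]; exact: m12.
Qed.

(** Both sides are finite measures whose values on rays are the mixed CDFs. Passing to real values
    through [fine] lets later steps subtract and divide freely. *)
Lemma mixture_laws_eq (R : realType) (a b : R)
    (P Q P' Q' : probability (measurableTypeR R) R) (F G F' G' : R -> R) :
  0 <= a <= 1 -> 0 <= b <= 1 ->
  is_cdf_of P F -> is_cdf_of Q G -> is_cdf_of P' F' -> is_cdf_of Q' G' ->
  mixture a F G = mixture b F' G' ->
  forall A, measurable A ->
  a * fine (P A) + (1 - a) * fine (Q A) =
  b * fine (P' A) + (1 - b) * fine (Q' A).
Proof.
move=> /andP[a0]; rewrite -subr_ge0 => a1 /andP[b0]; rewrite -subr_ge0 => b1.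
move=> PF QG PF' QG' mixE A mA.
pose m1 : {measure set (measurableTypeR R) -> \bar R} :=
  measure_add (mscale (NngNum a0) P) (mscale (NngNum a1) Q).
pose m2 : {measure set (measurableTypeR R) -> \bar R} :=
  measure_add (mscale (NngNum b0) P') (mscale (NngNum b1) Q').
have m1E B : measurable B -> m1 B = (a * fine (P B) + (1 - a) * fine (Q B))%:E.
  move=> mB; transitivity (a%:E * P B + (1 - a)%:E * Q B)%E; first exact: measure_addE.
  by rewrite -(fineK (fin_num_measure P B mB)) -(fineK (fin_num_measure Q B mB)).
have m2E B : measurable B -> m2 B = (b * fine (P' B) + (1 - b) * fine (Q' B))%:E.
  move=> mB; transitivity (b%:E * P' B + (1 - b)%:E * Q' B)%E; first exact: measure_addE.
  by rewrite -(fineK (fin_num_measure P' B mB)) -(fineK (fin_num_measure Q' B mB)).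
apply: EFin_inj; rewrite -m1E // -m2E //.
apply: (@finite_measure_unique_rays R m1 m2) => // x; first by rewrite m1E ?ltry.
by rewrite m1E // m2E // -PF -QG -PF' -QG' /= -!/(mixture _ _ _ x) mixE.
Qed.


(** * Countable carriers of purely atomic laws *)

(* Each rational splits an atom into a null half and a full half. Two distinct
   points are separated by some rational, so at most one point survives the
   removal of all the null halves. *)
Lemma atom_point (R : realType) (P : probability (measurableTypeR R) R)
    (A : set R) :
  is_atom P A -> exists2 x, A x & P [set x] = P A.
Proof.
case=> mA A0 atomA; have {}A0 : (0 < P A)%E by [].
have PA : (P A < +oo)%E by rewrite -ge0_fin_numE // fin_num_measure.
pose L (q : rat) : set R := A `&` `]-oo, ratr q].
have mL q : measurable (L q : set (measurableTypeR R)).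
  by apply: measurableI => //; exact: measurable_itv.
pose N q := if P (L q) == 0%E then L q else A `\` L q.
have mN q : measurable (N q : set (measurableTypeR R)).
  by rewrite /N; case: ifP => // _; exact: measurableD.
have N0 q : P (N q) = 0%E.
  rewrite /N; case: ifPn => [/eqP //|L0].
  have LA : L q `<=` A by exact: subIsetl.
  have [/eqP|LE] := atomA _ (mL q) LA; first by rewrite (negbTE L0).
  transitivity (P A - P (L q))%E; first by rewrite measureD // setIidr.
  by rewrite (_ : P (L q) = P A) // subee // fin_num_measure.
(* Kept abstract: unification must not unfold the encoding of [rat]. *)
have [e [e' eK]] : exists (e : rat -> nat) e', pcancel e e'.
  by exists pickle, unpickle; exact: pickleK.
pose N' n := if e' n is Some q then N q else set0.
have mN' n : measurable (N' n : set (measurableTypeR R)).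
  by rewrite /N'; case: (e' _).
have mUN : measurable (\bigcup_n N' n : set (measurableTypeR R)).
  exact: bigcup_measurable.
have UN0 : P (\bigcup_n N' n) = 0%E.
  apply/negligibleP => //; apply: negligible_bigcup => n.
  apply/negligibleP; first exact: mN'.
  by rewrite /N'; case: (e' _) => [q|]; [exact: N0|exact: measure0].
pose B := A `\` \bigcup_n N' n.
have PB : P B = P A.
  transitivity (P A - P (A `&` \bigcup_n N' n))%E; first exact: measureD.
  rewrite (_ : P (A `&` _) = 0%E) ?sube0 //.
  by apply: subset_measure0 UN0 => //; exact: measurableI.
have [x [Ax Nx]] : B !=set0.
  by apply/set0P; apply: contraTneq A0 => B0; rewrite -PB B0 measure0 ltxx.
exists x => //; rewrite -PB; congr (P _); apply/seteqP; split=> [_ -> //|y [Ay Ny]].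
have avoid z q : ~ (\bigcup_n N' n) z -> ~ N q z.
  by move=> Nz Nqz; apply: Nz; exists (e q) => //; rewrite /N' eK.
have sep u v : A u -> A v -> ~ (\bigcup_n N' n) u -> ~ (\bigcup_n N' n) v -> ~ u < v.
  move=> Au Av Nu Nv /rat_in_itvoo[q]; rewrite in_itv /= => /andP[uq qv].
  have := avoid _ q Nu; have := avoid _ q Nv; rewrite /N; case: ifP => _ NNv NNu.
    by apply: NNu; split => //=; rewrite in_itv /= ltW.
  by apply: NNv; split => // -[_] /=; rewrite in_itv /= leNgt qv.
by case: (ltgtP x y) => [xy|yx|//]; [case: (sep x y)|case: (sep y x)].
Qed.

(** The carrier is the set of points of positive mass. If its complement were charged, it would
    contain an atom, hence by [atom_point] a point of positive mass. *)
Lemma purely_atomic_countable (R : realType)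
    (P : probability (measurableTypeR R) R) :
  purely_atomic P -> exists2 D : set R, countable D & P D = 1%E.
Proof.
move=> atomicP.
(* The identity is taken as a random variable, so that its [pmf] gives the point masses of [P]. *)
pose X : measurableTypeR R -> R := idfun.
pose mX := isMeasurableFun.Build _ _ (measurableTypeR R) R X (@measurable_id _ _ setT).
pose X' : {RV P >-> R} := HB.pack X mX.
pose D := [set r | 0 < pmf X' r].
have cD : countable D := pmf_gt0_countable X'.
exists D => //.
have mD : measurable (D : set (measurableTypeR R)) by exact: countable_measurable.
apply/eqP; rewrite -(setCK D) probability_setC; last exact: measurableC.
suff -> : P (~` D) = 0%E by rewrite sube0.
apply/eqP; rewrite -measure_le0 leNgt; apply/negP => D0.
have [|B BD atomB] := atomicP (~` D) _ D0; first exact: measurableC.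
have [x Bx xB] := atom_point _ _ _ atomB.
have [_ B0 _] := atomB.
apply: (BD _ Bx); rewrite /D /= /pmf /= preimage_id xB fine_gt0 // B0 /=.
by rewrite -ge0_fin_numE // fin_num_measure //; case: atomB.
Qed.

(** * Elementary facts on [alpha0] *)

Lemma alpha0_le (R : realType) (H Hb : R -> R) (g : R) :
  0 < g <= 1 -> is_cdf (fun x => (H x - (1 - g) * Hb x) / g) ->
  alpha0 H Hb <= g.
Proof.
by move=> g01 Hg; apply: ge_inf => //; exists 0 => h [/andP[/ltW]].
Qed.

(** Every weight in (0, 1] is feasible, because [H] is a mixture of itself with itself. This settles
    the degenerate cases below. *)
Lemma alpha0_self (R : realType) (H : R -> R) : is_cdf H -> alpha0 H H = 0.
Proof.
move=> cdfH.
have scaled g : 0 < g -> is_cdf (fun x => (H x - (1 - g) * H x) / g).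
  move=> g0; rewrite (_ : (fun _ => _) = H) //.
  by apply/funext => x; field; rewrite gt_eqF.
apply/eqP; rewrite eq_le; apply/andP; split; last first.
  apply: lb_le_inf => [|h [/andP[/ltW]] //].
  by exists 1; split; rewrite ?ltr01 ?lexx //; exact: scaled.
apply/ler_addgt0Pr => e e0; rewrite add0r.
have m0 : 0 < Num.min e 1 by rewrite lt_min e0 ltr01.
apply: le_trans (_ : Num.min e 1 <= e); last by rewrite ge_min lexx.
by apply: alpha0_le; [rewrite m0 ge_min lexx orbT|exact: scaled].
Qed.

(** * Restriction of a mixture to a carrier of one component *)

Lemma probability_setI1 (R : realType)
    (P : probability (measurableTypeR R) R) (M A : set R) :
  measurable (M : set (measurableTypeR R)) ->
  measurable (A : set (measurableTypeR R)) ->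
  P M = 1%E -> P (A `&` M) = P A.
Proof.
move=> mM mA PM.
have PMC : P (~` M) = 0%E by rewrite probability_setC // PM subee.
transitivity (P (A `\` M) + P (A `&` M))%E; last first.
  by rewrite -measureDI.
rewrite (_ : P (A `\` M) = 0%E) ?add0e //.
apply: subset_measure0 PMC => //; [exact: measurableD|exact: measurableC].
Qed.

(* The signal is [P_G] conditioned on [M]; when [P_G M = 0] the bound degenerates
   to [alpha0 F_a F_a = 0]. *)
Lemma alpha0_le_restriction (R : realType) (k kb g : R)
    (P_a P_ba P_G : probability (measurableTypeR R) R) (F_a F_ba : R -> R)
    (M : set R) :
  0 < k -> 0 < g <= 1 -> 0 <= kb ->
  is_cdf_of P_a F_a -> is_cdf_of P_ba F_ba ->
  measurable (M : set (measurableTypeR R)) -> P_a M = 1%E -> P_ba M = 1%E ->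
  (forall A : set (measurableTypeR R), measurable A -> A `<=` M ->
    g * fine (P_G A) + (1 - g) * (kb * fine (P_ba A)) = k * fine (P_a A)) ->
  alpha0 F_a F_ba <= 1 - (1 - g) * kb / k.
Proof.
move=> k0 /andP[g0 g1] kb0 PaF PbaF mM PaM PbaM PG.
have mray (x : R) : measurable (`]-oo, x] : set (measurableTypeR R)).
  exact: measurable_itv.
have mrayM (x : R) : measurable (`]-oo, x] `&` M : set (measurableTypeR R)).
  exact: measurableI.
pose p := fine (P_G M); pose G x := fine (P_G (`]-oo, x] `&` M)).
have p0 : 0 <= p by rewrite fine_ge0.
have pE : g * p + (1 - g) * kb = k.
  by have := PG M mM (@subset_refl _ M); rewrite PaM PbaM /= !mulr1.
have GE x : g * G x + (1 - g) * (kb * F_ba x) = k * F_a x.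
  rewrite -[F_a x]/(fine (F_a x)%:E) -[F_ba x]/(fine (F_ba x)%:E) PaF PbaF.
  rewrite -(@probability_setI1 _ P_a M) // -(@probability_setI1 _ P_ba M) //.
  by apply: PG => //; exact: subIsetr.
have kN0 : k != 0 by rewrite gt_eqF.
have gN0 : g != 0 by rewrite gt_eqF.
(* If [p = 0], the signal vanishes on [M], so [F_a = F_ba] and the bound is 0. *)
have [p_eq0|pN0] := eqVneq p 0.
  have G0 x : G x = 0.
    apply/eqP; rewrite eq_le -{1}p_eq0 fine_ge0 // andbT.
    by rewrite fine_le ?fin_num_measure // le_measure ?inE //; exact: subIsetr.
  have kE : k = (1 - g) * kb by rewrite -pE p_eq0 mulr0 add0r.
  rewrite (_ : F_a = F_ba).
    by rewrite alpha0_self -?kE ?divff ?subrr //; exists P_ba.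
  apply/funext => x; apply: (mulfI kN0).
  by rewrite -GE G0 mulr0 add0r mulrA -kE.
have {}p0 : 0 < p by rewrite lt_neqAle eq_sym pN0.
have -> : 1 - (1 - g) * kb / k = g * p / k by rewrite -pE; field; rewrite pE.
apply: alpha0_le.
  rewrite divr_gt0 ?mulr_gt0 //= ler_pdivrMr // mul1r -pE lerDl.
  by rewrite mulr_ge0 // subr_ge0.
(* The second argument is the value [mnormalize] takes at zero or infinite mass; here the mass is
   [p], positive and finite. *)
exists (mnormalize (mrestr P_G mM) P_G) => x.
have PGM : P_G M = p%:E by rewrite fineK // fin_num_measure.
rewrite /= /mnormalize /= /mrestr setTI PGM eqe (negbTE pN0) /=.
rewrite -(fineK (fin_num_measure P_G _ (mrayM x))) -EFinM -/(G x).
congr (_%:E); apply: (mulfI (mulf_neq0 gN0 pN0)).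
transitivity (k * F_a x - (k - g * p) * F_ba x); first by field; rewrite kN0 gN0 pN0.
by rewrite -GE -pE; field.
Qed.

(* The relation between [k], [ks], [kb] and [alpha] comes from evaluating both
   decompositions of [F] on [M]. *)
Lemma identifiable_of_component (R : realType) (alpha k ks kb : R)
    (F F_s F_b F_a F_d F_sa F_sd F_ba F_bd : R -> R)
    (P_a P_d P_sa P_sd P_ba P_bd : probability (measurableTypeR R) R)
    (M : set R) :
  0 <= alpha <= 1 -> 0 < k < 1 -> 0 < ks < 1 -> 0 < kb < 1 ->
  is_cdf F_s -> is_cdf F_b ->
  is_cdf_of P_a F_a -> is_cdf_of P_d F_d ->
  is_cdf_of P_sa F_sa -> is_cdf_of P_sd F_sd ->
  is_cdf_of P_ba F_ba -> is_cdf_of P_bd F_bd ->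
  F = mixture alpha F_s F_b -> F = mixture k F_a F_d ->
  F_s = mixture ks F_sa F_sd -> F_b = mixture kb F_ba F_bd ->
  measurable (M : set (measurableTypeR R)) ->
  P_a M = 1%E -> P_sa M = 1%E -> P_ba M = 1%E ->
  P_d M = 0%E -> P_sd M = 0%E -> P_bd M = 0%E ->
  identifiable F_a (alpha * ks / k) F_ba -> identifiable F alpha F_b.
Proof.
move=> /andP[al0 al1] /andP[k0 k1] /andP[ks0 ks1] /andP[kb0 kb1] cdfFs [P_b PbF].
move=> PaF PdF PsaF PsdF PbaF PbdF FE FadE FsE FbE mM PaM PsaM PbaM PdM PsdM PbdM.
have [P_s PsF] := cdfFs.
move=> idFa.
have null (P : probability (measurableTypeR R) R) (A : set (measurableTypeR R)) :
    P M = 0%E -> measurable A -> A `<=` M -> fine (P A) = 0.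
  by move=> PM mA AM; rewrite (_ : P A = 0%E) //; exact: subset_measure0 PM.
(* A single law counts as a mixture of itself with itself of weight 1, so [mixture_laws_eq] also
   compares [P_s] and [P_b] with their decompositions. *)
have mixId a (H : R -> R) : mixture a H H = H.
  by apply/funext => x; rewrite /mixture; ring.
have i01 (a : R) : 0 < a -> a <= 1 -> 0 <= a <= 1 by move=> /ltW -> ->.
have k01 := i01 _ k0 (ltW k1); have ks01 := i01 _ ks0 (ltW ks1).
have kb01 := i01 _ kb0 (ltW kb1); have one01 := i01 _ (@ltr01 R) (lexx _).
have PsE (A : set (measurableTypeR R)) :
    measurable A -> A `<=` M -> fine (P_s A) = ks * fine (P_sa A).
  move=> mA AM; have := mixture_laws_eq _ _ _ P_s P_s P_sa P_sd _ _ _ _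
    one01 ks01 PsF PsF PsaF PsdF _ _ mA.
  by rewrite mixId subrr mul1r mul0r (null P_sd) // mulr0 !addr0; apply.
have PbE (A : set (measurableTypeR R)) :
    measurable A -> A `<=` M -> fine (P_b A) = kb * fine (P_ba A).
  move=> mA AM; have := mixture_laws_eq _ _ _ P_b P_b P_ba P_bd _ _ _ _
    one01 kb01 PbF PbF PbaF PbdF _ _ mA.
  by rewrite mixId subrr mul1r mul0r (null P_bd) // mulr0 !addr0; apply.
have mixM g (P_G : probability (measurableTypeR R) R) G : 0 <= g <= 1 ->
    is_cdf_of P_G G -> F = mixture g G F_b ->
    forall A : set (measurableTypeR R), measurable A -> A `<=` M ->
    g * fine (P_G A) + (1 - g) * (kb * fine (P_ba A)) =
    k * fine (P_a A).
  move=> g01 PGG FgE A mA AM; rewrite -PbE //.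
  have := mixture_laws_eq _ _ _ P_G P_b P_a P_d _ _ _ _
    g01 k01 PGG PbF PaF PdF _ _ mA.
  by rewrite (null P_d) // mulr0 addr0; apply; rewrite -FgE.
have kE : k = alpha * ks + (1 - alpha) * kb.
  have al01 : 0 <= alpha <= 1 by rewrite al0.
  have := mixM _ _ _ al01 PsF FE M mM (@subset_refl _ M).
  by rewrite PsE // PaM PsaM PbaM /= !mulr1.
(* The weight 0 is never feasible, so for [alpha = 0] the infimum is computed directly. *)
have [al_eq0|alN0] := eqVneq alpha 0.
  rewrite /identifiable FE al_eq0 (_ : mixture 0 F_s F_b = F_b).
    by apply: alpha0_self; exists P_b.
  by apply/funext => x; rewrite /mixture; ring.
have {}al0 : 0 < alpha by rewrite lt_neqAle eq_sym alN0.
have alS : is_cdf (fun x => (F x - (1 - alpha) * F_b x) / alpha).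
  rewrite (_ : (fun _ => _) = F_s) //.
  by apply/funext => x; rewrite FE /mixture; field.
apply/eqP; rewrite eq_le alpha0_le ?al0 //=.
apply: lb_le_inf => [|g [/andP[g0 g1] [P_G PGG]]].
  by exists alpha; rewrite /= al0.
have gN0 : g != 0 by rewrite gt_eqF.
have FgE : F = mixture g (fun x => (F x - (1 - g) * F_b x) / g) F_b.
  by apply/funext => x; rewrite /mixture; field.
have := alpha0_le_restriction _ _ _ _ _ _ P_G _ _ _ k0 _ (ltW kb0) PaF PbaF mM
  PaM PbaM (mixM _ _ _ (i01 _ g0 g1) PGG FgE).
rewrite idFa g0 g1 => /(_ isT) le_g; rewrite -subr_ge0.
(* By [kE], the two sides of [le_g] differ by exactly this quantity, and [kb] and [k] are
   positive. *)
have : 0 <= (g - alpha) * kb / k.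
  move: le_g; rewrite -subr_ge0; congr (0 <= _).
  by rewrite [in RHS]kE [in LHS]kE; field; rewrite -kE gt_eqF.
by rewrite pmulr_lge0 ?invr_gt0 // pmulr_lge0.
Qed.

(** * A common carrier and the conclusion *)

Lemma countableU (T : Type) (A B : set T) :
  countable A -> countable B -> countable (A `|` B).
Proof.
move=> cA cB; rewrite -bigcup2inE; apply: bigcup_countable => // i _.
by case: i => [|[|i]] //=; exact: countable0.
Qed.

Lemma probability_subset1 (R : realType)
    (P : probability (measurableTypeR R) R) (D N : set R) :
  measurable (D : set (measurableTypeR R)) ->
  measurable (N : set (measurableTypeR R)) ->
  D `<=` N -> P D = 1%E -> P N = 1%E.
Proof.
move=> mD mN DN PD; apply/eqP; rewrite eq_le probability_le1 //= -PD.
by rewrite le_measure ?inE.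
Qed.

Theorem lemma5 (R : realType) (alpha kappa kappa_s kappa_b : R)
  (F F_s F_b F_a F_d F_sa F_sd F_ba F_bd : R -> R)
  (halpha : 0 <= alpha <= 1)
  (hF_s : is_cdf F_s) (hF_b : is_cdf F_b) (hne : F_s <> F_b)
  (hF : F = mixture alpha F_s F_b)
  (hkappa : 0 < kappa < 1)
  (hF_a : abs_continuous_cdf F_a) (hF_d : piecewise_constant_cdf F_d)
  (hF_ad : F = mixture kappa F_a F_d)
  (hkappa_s : 0 < kappa_s < 1)
  (hF_sa : abs_continuous_cdf F_sa) (hF_sd : piecewise_constant_cdf F_sd)
  (hF_s_ad : F_s = mixture kappa_s F_sa F_sd)
  (hkappa_b : 0 < kappa_b < 1)
  (hF_ba : abs_continuous_cdf F_ba) (hF_bd : piecewise_constant_cdf F_bd)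
  (hF_b_ad : F_b = mixture kappa_b F_ba F_bd) :
  identifiable F_a (alpha * kappa_s / kappa) F_ba \/
  identifiable F_d (alpha * (1 - kappa_s) / (1 - kappa)) F_bd ->
  identifiable F alpha F_b.
Proof.
case: hF_a hF_sa hF_ba => [P_a PaF dP_a] [P_sa PsaF dP_sa] [P_ba PbaF dP_ba].
case: hF_d hF_sd hF_bd => [P_d PdF /purely_atomic_countable[D_d cD_d PD_d]].
move=> [P_sd PsdF /purely_atomic_countable[D_sd cD_sd PD_sd]].
move=> [P_bd PbdF /purely_atomic_countable[D_bd cD_bd PD_bd]].
(* One countable set carries all three discrete laws; being Lebesgue null, it is negligible for the
   three absolutely continuous ones. *)
pose N : set (measurableTypeR R) := D_d `|` D_sd `|` D_bd.
have cN : countable N by do 2![apply: countableU => //].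
have cmeas (D : set (measurableTypeR R)) : countable D -> measurable D.
  exact: countable_measurable.
have mN := cmeas _ cN.
have PdN : P_d N = 1%E.
  by apply: probability_subset1 PD_d => //; [exact: cmeas|move=> x; left; left].
have PsdN : P_sd N = 1%E.
  by apply: probability_subset1 PD_sd => //; [exact: cmeas|move=> x; left; right].
have PbdN : P_bd N = 1%E.
  by apply: probability_subset1 PD_bd => //; [exact: cmeas|move=> x; right].
have dominated0 (P : probability (measurableTypeR R) R) :
    P `<< (@lebesgue_measure R) -> P N = 0%E.
  by move=> /null_content_dominatesP; apply => //;
  exact: countable_lebesgue_measure0.
have PaN := dominated0 _ dP_a; have PsaN := dominated0 _ dP_sa.
have PbaN := dominated0 _ dP_ba.
have onem_itv01 (a : R) : 0 < a < 1 -> 0 < 1 - a < 1.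
  by move=> a01; rewrite subr_gt0 gtrBl andbC.
have mixC a (G H : R -> R) : mixture a G H = mixture (1 - a) H G.
  by apply/funext => x; rewrite /mixture; ring.
case=> [id_a|id_d].
  apply: (@identifiable_of_component R alpha kappa kappa_s kappa_b F F_s F_b
    F_a F_d F_sa F_sd F_ba F_bd P_a P_d P_sa P_sd P_ba P_bd (~` N)) => //;
  by [exact: measurableC|rewrite probability_setC //
    ?PaN ?PsaN ?PbaN ?PdN ?PsdN ?PbdN ?sube0 ?subee].
(* The discrete case is the same lemma with the two components exchanged, each weight replaced by
   its complement, and [N] in place of its complement. *)
apply: (@identifiable_of_component R alpha (1 - kappa) (1 - kappa_s)
  (1 - kappa_b) F F_s F_b F_d F_a F_sd F_sa F_bd F_ba
  P_d P_a P_sd P_sa P_bd P_ba N) => //; by [exact: onem_itv01|rewrite -mixC].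
Qed.
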